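(* Let $G$ be a discrete group, $\sigma$ a two-cocycle on $G$, and $H$ a normal subgroup of $G$. Assume that $H$ is prime. Then $(H\le G,\sigma)$ satisfies the relative Kleppner condition if and only if $(H,\sigma)$ satisfies Kleppner's condition and $C^\sigma_G(H)$ is trivial.
   Context: A two-cocycle on a discrete group $G$ (identity $e$) is a map $\sigma\colon G\times G\to\mathbb{T}$ (unit circle) with $\sigma(g,h)\sigma(gh,k)=\sigma(g,hk)\sigma(h,k)$ and $\sigma(g,e)=\sigma(e,g)=1$ for all $g,h,k\in G$. Its restriction to a subgroup is again denoted $\sigma$. For $H\le G$ and $g\in G$, the $H$-conjugacy class of $g$ is $g^H=\{hgh^{-1}:h\in H\}$; it is nontrivial if $g\ne e$. An element $g\in G$ is $\sigma$-regular w.r.t. $H$ if $\sigma(g,h)=\sigma(h,g)$ whenever $h\in H$ and $gh=hg$; this is a property of $H$-conjugacy classes. $(H\le G,\sigma)$ satisfies the relative Kleppner condition if every nontrivial $H$-conjugacy class in $G$ that is $\sigma$-regular w.r.t. $H$ is infinite. $(H,\sigma)$ satisfies Kleppner's condition if every nontrivial conjugacy class of $H$ that is $\sigma$-regular w.r.t. $H$ is infinite (i.e., the previous condition with $G=H$). $C_G^\sigma(H)=\{g\in C_G(H): \sigma(g,h)=\sigma(h,g)\text{ for all }h\in H\}$, where $C_G(H)$ is the centralizer of $H$ in $G$. A group is prime if it has no finite normal subgroup except the trivial one; equivalently, its FC-center (the subgroup of elements with finite conjugacy class) is torsion-free. *)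

(* Defs.v *)
From mathcomp Require Export all_boot all_order all_algebra.
From mathcomp Require Export all_classical all_reals.
From mathcomp Require Export complex.

Set Implicit Arguments.
Unset Strict Implicit.
Unset Printing Implicit Defensive.

Local Open Scope classical_set_scope.
Local Open Scope group_scope.

(* Subgroups are predicates on the ambient, possibly infinite, [groupType];   *)
(* [group_closed] is the subgroup test of mathcomp.boot.monoid.               *)

Definition normal_subgroup (G : groupType) (H N : {pred G}) : Prop :=
  [/\ group_closed N, {subset N <= H}
    & forall h n, h \in H -> n \in N -> h * n * h^-1 \in N].

Definition prime_subgroup (G : groupType) (H : {pred G}) : Prop :=
  forall N : {pred G},
    normal_subgroup H N -> finite_set [set` N] -> [set` N] = [set 1].

Record two_cocycle (R : realType) (G : groupType) (sigma : G -> G -> R[i]) :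
  Prop := TwoCocycle {
    two_cocycle_circle : forall g h, (`|sigma g h| = 1)%R;
    two_cocycle_mul : forall g h k,
      (sigma g h * sigma (g * h)%g k = sigma g (h * k)%g * sigma h k)%R;
    two_cocycle_1r : forall g, sigma g 1 = 1%R;
    two_cocycle_1l : forall g, sigma 1 g = 1%R
  }.

(* The library's conjugation [g ^ h] is [h^-1 * g * h], not [h * g * h^-1].   *)
Definition conj_class (G : groupType) (H : {pred G}) (g : G) : set G :=
  [set h * g * h^-1 | h in [set` H]].

Definition sigma_regular (R : realType) (G : groupType)
    (sigma : G -> G -> R[i]) (H : {pred G}) (g : G) : Prop :=
  forall h, h \in H -> commute g h -> sigma g h = sigma h g.

(* The relative Kleppner condition for a pair of subgroups [H <= K] of [G].   *)
(* Nontrivial, regular and infinite only depend on the [H]-conjugacy class,   *)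
(* so quantifying over its representatives [g] is quantifying over classes.   *)
Definition relative_kleppner (R : realType) (G : groupType)
    (sigma : G -> G -> R[i]) (K H : {pred G}) : Prop :=
  forall g, g \in K -> g <> 1 -> sigma_regular sigma H g ->
    infinite_set (conj_class H g).

Definition kleppner (R : realType) (G : groupType)
    (sigma : G -> G -> R[i]) (H : {pred G}) : Prop :=
  relative_kleppner sigma H H.

Definition centralizer (G : groupType) (H : {pred G}) : set G :=
  [set g | forall h, h \in H -> commute g h].

Definition sigma_centralizer (R : realType) (G : groupType)
    (sigma : G -> G -> R[i]) (H : {pred G}) : set G :=
  [set g | centralizer H g /\ forall h, h \in H -> sigma g h = sigma h g].

(* Main.v *)
Require Import Defs.
From mathcomp Require Import ring.

(* Forward: an element of the sigma-centralizer is regular with a one-point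
   class.  Backward: let Z be the elements of H with finitely many H-conjugates.
   As H is prime, Z is torsion-free and abelian, n-th roots in Z are unique, and
   every element of G with finite H-class commutes with Z.  Let g be regular with
   finite H-class X.  The quotients of elements of X lie in Z, so X is a commuting
   set and w, the product of X, centralizes H.  For m = |X|!, each h ^ m in H
   commutes with all of X, so regularity of X makes w ^ m sigma-commute with H;
   hence w ^ m = 1, and reducing modulo H gives g ^ N in H for N = |X| m.  By
   uniqueness of roots, g and g ^ N have the same centralizer in H, so g ^ N is
   regular in H with finite class, thus trivial.  Then g centralizes H, so g is in
   the sigma-centralizer, which is trivial. *)

Set Implicit Arguments.
Unset Strict Implicit.
Unset Printing Implicit Defensive.

Import GRing.Theory Num.Theory.

Local Open Scope classical_set_scope.
Local Open Scope group_scope.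

(** * Counting lemmas and conjugation orbits *)

Lemma pigeonhole_seq (T : eqType) (f : nat -> T) (s : seq T) :
  (forall i, f i \in s) -> exists i j, [/\ i < j, j <= size s & f i = f j]%N.
Proof.
move=> fs; have /(uniqPn (f 0%N))[i [j [ij]]] : ~~ uniq (mkseq f (size s).+1).
  apply: contraFN (ltnn (size s)) => /uniq_leq_size fs_le.
  rewrite -{1}(size_mkseq f (size s).+1) fs_le // => _ /mapP[i _ ->].
  exact: fs.
rewrite size_mkseq ltnS => js.
by rewrite !nth_mkseq ?ltnS // ?(leq_trans (ltnW ij)) //; exists i, j.
Qed.

(** Serves to show that a set is finite once each of its elements is given by a word of bounded
    length. *)
Lemma bounded_words (T : eqType) (s : seq T) (n : nat) :
  exists W : seq (seq T),
    forall w, {subset w <= s} -> (size w <= n)%N -> w \in W.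
Proof.
elim: n => [|n [W WP]]; first by exists [:: [::]] => -[].
exists ([::] :: [seq x :: w | x <- s, w <- W]) => -[//|x w] xws wn.
rewrite inE /=; apply/allpairs_f; first exact/xws/mem_head.
by apply: WP => // y yw; apply: xws; rewrite inE yw orbT.
Qed.

Lemma size_le_sum_count (T : eqType) (s w : seq T) :
  {subset w <= s} -> (size w <= \sum_(x <- s) count_mem x w)%N.
Proof.
elim: w => [//|y w IHw] yws /=; rewrite big_split /= -add1n leq_add //.
  have ys : y \in s by exact/yws/mem_head.
  by rewrite (big_rem y) //= eqxx.
by apply: IHw => z zw; apply: yws; rewrite inE zw orbT.
Qed.

Lemma expg_sub_eq1 (G : groupType) (x : G) (i j : nat) :
  (i <= j)%N -> x ^+ i = x ^+ j -> x ^+ (j - i) = 1.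
Proof. by move=> ij e; rewrite expgnFr // -e mulgV. Qed.

Lemma conj_eq_commute (G : groupType) (x y : G) : x ^ y = x <-> commute x y.
Proof.
split=> [e|c]; first by rewrite /commute conjgC e.
by rewrite conjgE c mulKg.
Qed.

(** Two of the conjugates of [g] by powers of [h] coincide. The bound on [m] makes it divide the
    factorial of [size s], an exponent independent of [h]. *)
Lemma finite_orbit_expg (G : groupType) (g h : G) (s : seq G) :
  (forall i, g ^ (h ^+ i) \in s) ->
  exists m, [/\ 0 < m, m <= size s & commute g (h ^+ m)]%N.
Proof.
move=> /pigeonhole_seq[i [j [ij js e]]]; exists (j - i)%N; split.
- by rewrite subn_gt0.
- exact: leq_trans (leq_subr _ _) js.
apply/conj_eq_commute; apply: (@conjg_inj _ (h ^+ i)).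
by rewrite -conjgM -expgnDr subnK // ltnW.
Qed.

(** * Products of words in a group *)

Section Words.
Local Close Scope classical_set_scope.

(* Collecting copies of [x] on the left conjugates the other letters by powers
   of [x], which leaves the copies of [x] unchanged. *)
Lemma prod_extract (G : groupType) (S : {pred G}) (x : G) (m : nat)
    (w : seq G) :
  {in S, forall y, y ^ x \in S} -> {subset w <= S} ->
  (m <= count_mem x w)%N ->
  exists w' : seq G, [/\ {subset w' <= S}, size w = (m + size w')%N
    & \prod_(y <- w) y = x ^+ m * \prod_(y <- w') y].
Proof.
move=> Sx; have Sxm k : {in S, forall y, y ^ (x ^+ k) \in S}.
  elim: k => [|k IHk] y yS; first by rewrite expg0 conjg1.
  by rewrite expgSr conjgM; apply/Sx/IHk.
elim: w m => [|y w IHw] [|m] ywS xw //.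
- by exists [::]; rewrite expg0 mul1g.
- by exists (y :: w); rewrite expg0 mul1g.
have wS : {subset w <= S} by move=> z zw; apply: ywS; rewrite inE zw orbT.
move: xw => /=; have [->|_] := eqVneq y x.
  rewrite add1n ltnS => /IHw-/(_ wS)[w' [w'S sw pw]].
  by exists w'; rewrite sw big_cons pw expgS mulgA.
rewrite add0n => /IHw-/(_ wS)[w' [w'S sw pw]].
exists (y ^ (x ^+ m.+1) :: w'); split.
- move=> z; rewrite inE => /predU1P[->|/w'S//].
  by apply/Sxm/ywS/mem_head.
- by rewrite /= sw !addnS.
- by rewrite !big_cons pw 2!mulgA (conjgC y).
Qed.

(* The word argument of Dietzmann's lemma: a long word contains some letter [n]
   times, and these [n] letters can be replaced by one factor [t]. *)
Lemma prod_reduce (G : groupType) (s : seq G) (n : nat) (t : G) (w : seq G) :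
  (0 < n)%N -> {in s &, forall x y, y ^ x \in s} ->
  {in s, forall x, x ^+ n = t} -> {subset w <= s} ->
  exists (q : nat) (w' : seq G), [/\ {subset w' <= s}, (size w' <= size s * n)%N,
    size w = (n * q + size w')%N
    & \prod_(x <- w) x = t ^+ q * \prod_(x <- w') x].
Proof.
move=> n0 sJ sn; have [k] := ubnP (size w); elim: k w => // k IHk w wk ws.
have [wle|wgt] := leqP (size w) (size s * n).
  by exists 0%N, w; rewrite muln0 expg0 mul1g.
have /hasP[x xs xn] : has (fun x => n <= count_mem x w)%N s.
  apply: contraLR wgt => /hasPn small; rewrite -leqNgt.
  apply: (leq_trans (size_le_sum_count ws)).
  rewrite -sum1_size big_distrl /= !big_seq; apply: leq_sum => x xs.
  by rewrite mul1n ltnW // ltnNge small.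
have [|w1 [w1s sw pw]] := prod_extract (S := mem s) _ ws xn.
  by move=> y; apply: sJ.
have [|q [w' [w's bw' sw1 pw1]]] := IHk w1 _ w1s.
  by rewrite -ltnS (leq_trans _ wk) // ltnS sw -[X in (X < _)%N]add0n ltn_add2r.
exists q.+1, w'; split=> //; first by rewrite sw sw1 mulnS addnA.
by rewrite pw pw1 sn // mulgA expgS.
Qed.

Lemma perm_prod_commute (G : groupType) (s t : seq G) :
  perm_eq s t -> {in s &, forall x y, commute x y} ->
  \prod_(x <- s) x = \prod_(x <- t) x.
Proof.
elim: s t => [|x s IHs] t.
  by rewrite perm_sym => /perm_nilP->.
move=> st comm; have xt : x \in t by rewrite -(perm_mem st) mem_head.
case/path.splitPr: xt st => t1 t2 st.
have e : perm_eq s (t1 ++ t2).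
  by rewrite -(perm_cons x) (perm_trans st) // -[x :: t2]cat1s perm_catCA.
rewrite big_cons big_cat big_cons /= (IHs _ e) ?big_cat /=; last first.
  by move=> y z ys zs; apply: comm; rewrite inE ?ys ?zs orbT.
rewrite !mulgA; congr (_ * _); rewrite big_seq; apply: commute_prod => y yt1.
by apply: comm; rewrite ?mem_head // (perm_mem st) mem_cat yt1.
Qed.

End Words.

(** * Elements with finitely many conjugates under [H] *)

Definition fin_class (G : groupType) (H : {pred G}) (g : G) : Prop :=
  exists s : seq G, forall h, h \in H -> g ^ h \in s.

Section FiniteClasses.
Local Close Scope classical_set_scope.
Variables (G : groupType) (H : {pred G}).
Hypothesis H_group : group_closed H.

Let H1 : 1 \in H := proj1 H_group.
Let HM : {in H &, forall x y, x * y \in H} := group_closedM H_group.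
Let HV : {in H, forall x, x^-1 \in H} := group_closedV H_group.

Lemma group_closedX (x : G) (n : nat) : x \in H -> x ^+ n \in H.
Proof.
move=> xH; elim: n => [|n IHn]; first by rewrite expg0.
by rewrite expgS; apply: HM.
Qed.

(** The two conventions for conjugation give the same class because [H] is closed under inverses. *)
Lemma fin_classP (g : G) :
  finite_set (conj_class H g) <-> fin_class H g.
Proof.
split=> [/finite_seqP[s sE]|[s sP]].
  exists s => h hH; suff : conj_class H g (g ^ h) by rewrite sE.
  by exists h^-1; rewrite ?invgK ?conjgE ?mulgA //; apply: HV.
apply: (sub_finite_set _ (finite_seq s)) => _ [h hH <-] /=.
by rewrite -mulgA -{1}[h]invgK; apply/sP/HV.
Qed.

Lemma fin_class_exact (g : G) : fin_class H g ->
  exists s : seq G,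
    uniq s /\ forall x, x \in s <-> exists2 h, h \in H & x = g ^ h.
Proof.
move=> [s sP].
exists (undup [seq x <- s | `[< exists2 h, h \in H & x = g ^ h >]]).
split=> [|x]; first exact: undup_uniq.
rewrite mem_undup mem_filter; split=> [/andP[/asboolP]//|xg].
by apply/andP; split; [exact/asboolP | case: xg => h hH ->; apply: sP].
Qed.

Lemma fin_classM (x y : G) :
  fin_class H x -> fin_class H y -> fin_class H (x * y).
Proof.
move=> [s sP] [t tP]; exists [seq a * b | a <- s, b <- t] => h hH.
by rewrite conjMg; apply: allpairs_f; [apply: sP | apply: tP].
Qed.

Lemma fin_classV (x : G) : fin_class H x -> fin_class H x^-1.
Proof.
move=> [s sP]; exists [seq y^-1 | y <- s] => h hH.
by rewrite conjVg map_f ?sP.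
Qed.

Lemma fin_classX (x : G) (n : nat) : fin_class H x -> fin_class H (x ^+ n).
Proof.
move=> [s sP]; exists [seq y ^+ n | y <- s] => h hH.
by rewrite conjXg (map_f (fun y => y ^+ n)) ?sP.
Qed.

Lemma fin_class_commX (x h : G) : fin_class H x -> h \in H ->
  exists2 n, (0 < n)%N & commute x (h ^+ n).
Proof.
move=> [s sP] hH.
have [i|n [n0 _ c]] := @finite_orbit_expg _ x h s; last by exists n.
exact/sP/group_closedX.
Qed.

(* Dietzmann's lemma: finitely many conjugates of finite order generate a finite
   normal subgroup. *)
Lemma torsion_fin_class_eq1 (a : G) (n : nat) :
  prime_subgroup H -> a \in H -> fin_class H a -> (0 < n)%N -> a ^+ n = 1 ->
  a = 1.
Proof.
move=> H_prime aH /fin_class_exact[s [_ sP]] n0 an1.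
have as_ : a \in s by apply/sP; exists 1; rewrite ?conjg1.
have sH x : x \in s -> x \in H.
  by move/sP=> [h hH ->]; rewrite conjgE; apply: HM; [apply: HV | apply: HM].
have sJ x h : x \in s -> h \in H -> x ^ h \in s.
  by move=> /sP[k kH ->] hH; apply/sP; exists (k * h); rewrite ?conjgM // HM.
have sn x : x \in s -> x ^+ n = 1.
  by move=> /sP[k kH ->]; rewrite -conjXg an1 conj1g.
have [W WP] := bounded_words s (size s * n).
pose is_word g := exists2 w : seq G, {subset w <= s} & g = \prod_(x <- w) x.
pose N : {pred G} := [pred g | `[< is_word g >]].
have NP g : g \in N <-> is_word g.
  by split=> [/asboolP|?] //; apply/asboolP.
have N_closed x y : x \in N -> y \in N -> x * y \in N.
  move=> /NP[u us ->] /NP[v vs ->]; apply/NP; exists (u ++ v).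
    by move=> z; rewrite mem_cat => /orP[/us|/vs].
  by rewrite big_cat.
have NV x : x \in N -> x^-1 \in N.
  move=> /NP[u us ->]; elim: u us => [|y u IHu] us.
    by rewrite big_nil invg1; apply/NP; exists [::]; rewrite ?big_nil.
  rewrite big_cons invgM; apply: N_closed.
    by apply: IHu => z zu; apply: us; rewrite inE zu orbT.
  (* As [y ^+ n = 1], the inverse of [y] is itself a word in [y]. *)
  apply/NP; exists (nseq n.-1 y).
    by move=> z /nseqP[-> _]; apply/us/mem_head.
  rewrite big_nseq iter_mulg_1; apply: mulg1_eq; rewrite -expgS prednK //.
  exact/sn/us/mem_head.
have : [set` N]%classic = [set 1]%classic.
  apply: H_prime; first split.
  - split; last by move=> x y xN yN; apply/N_closed/NV.
    by apply/NP; exists [::]; rewrite ?big_nil.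
  - move=> _ /NP[u us ->]; elim: u us => [|y u IHu] us; first by rewrite big_nil.
    rewrite big_cons; apply: HM; first exact/sH/us/mem_head.
    by apply: IHu => z zu; apply: us; rewrite inE zu orbT.
  - move=> h _ hH /NP[u us ->]; apply/NP; exists [seq x ^ h^-1 | x <- u].
      by move=> _ /mapP[x /us xs ->]; apply/sJ/HV.
    by rewrite -mulgA -{1}[h]invgK -conjgE conjg_prod big_map.
  - apply: sub_finite_set (finite_seq [seq \prod_(x <- w) x | w <- W]).
    move=> _ /NP[u us ->] /=.
    have sJs : {in s &, forall x y, y ^ x \in s}.
      by move=> x y xs ys; apply/sJ/sH.
    (* Here [t = 1], so only the short word remains. *)
    have [q [w [ws wn _ ->]]] := prod_reduce n0 sJs sn us.
    by rewrite expg1n mul1g (map_f (fun w => \prod_(x <- w) x)) ?WP.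
move=> /seteqP[/(_ a) + _]; apply; apply/NP; exists [:: a].
  by move=> x; rewrite inE => /eqP->.
by rewrite big_seq1.
Qed.

(* Over the conjugates of [a] and [b] by the centralizer of [t = a ^+ n], every
   letter is an [n]-th root of [t].  The powers of [b / a] are words of length
   divisible by [n] times powers of [t], of total degree zero, so after reduction
   only finitely many of them remain and [b / a] is torsion. *)
Lemma fin_class_roots_unique (a b : G) (n : nat) :
  prime_subgroup H -> a \in H -> b \in H -> fin_class H a -> fin_class H b ->
  (0 < n)%N -> a ^+ n = b ^+ n -> a = b.
Proof.
move=> H_prime aH bH fa fb n0 anbn.
have [sa saP] := fa; have [sb sbP] := fb; pose t := a ^+ n.
pose P x := exists h, [/\ h \in H, commute t h & x = a ^ h \/ x = b ^ h].
pose s := [seq x <- sa ++ sb | `[< P x >]].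
have sP x : x \in s <-> P x.
  rewrite mem_filter mem_cat; split=> [/andP[/asboolP]//|Px].
  apply/andP; split; first exact/asboolP.
  by case: Px => h [hH _ [->|->]]; rewrite ?saP ?sbP ?orbT.
have sn x : x \in s -> x ^+ n = t.
  by move=> /sP[h [_ th [->|->]]]; rewrite -conjXg -?anbn; apply/conj_eq_commute.
have st x : x \in s -> commute t x.
  by move=> /sn <-; apply/commute_sym/commuteX/commute_refl.
have sH x : x \in s -> x \in H.
  move=> /sP[h [hH _ [->|->]]]; rewrite conjgE.
    by do 2?apply: HM => //; apply: HV.
  by do 2?apply: HM => //; apply: HV.
have sJ : {in s &, forall x y, y ^ x \in s}.
  move=> x y xs /sP[h [hH th yh]]; apply/sP; exists (h * x); split.
  - exact/HM/sH.
  - exact/commuteM/st.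
  - by case: yh => ->; rewrite !conjgM; [left|right].
have as_ : a \in s.
  by apply/sP; exists 1; rewrite !conjg1; split=> //; [apply: commute1|left].
have bs : b \in s.
  by apply/sP; exists 1; rewrite !conjg1; split=> //; [apply: commute1|right].
have [W WP] := bounded_words s (size s * n).
(* Letters have degree 1 and [t] has degree [n]. The words met below have length divisible by [n],
   and [red] brings them to degree zero. *)
pose red (w : seq G) := t ^- (size w %/ n) * \prod_(x <- w) x.
have powers k : (b / a) ^+ k \in [seq red w | w <- W].
  (* The word [u] replaces [b / a] by positive letters, since [a^-1 * t = a ^+ n.-1]. *)
  pose u := b :: nseq n.-1 a; pose v := flatten (nseq k u).
  have us : {subset u <= s}.
    move=> x; rewrite inE => /predU1P[->//|/nseqP[-> _]] //.
  have vs : {subset v <= s}.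
    by move=> x /flattenP[y /nseqP[-> _] /us].
  have pu : \prod_(x <- u) x = b / a * t.
    rewrite big_cons big_nseq iter_mulg_1 -mulgA; congr (_ * _).
    by rewrite /t -{2}(prednK n0) expgS mulKg.
  have ct : commute (b / a) t.
    apply/commute_sym/commuteM; first exact: st.
    exact/commuteV/st.
  have pv : \prod_(x <- v) x = (b / a) ^+ k * t ^+ k.
    rewrite -expgMn // -pu /v; elim: (k) => [|i IHi]; first by rewrite big_nil.
    by rewrite /= -cat_cons big_cat IHi expgS.
  have sv : size v = (n * k)%N.
    rewrite size_flatten /shape map_nseq sumn_nseq /= size_nseq prednK //.
  have [q [w [ws wn sw pw]]] := prod_reduce n0 sJ sn vs.
  have qk : (q <= k)%N by rewrite -(leq_pmul2l n0) -sv sw leq_addr.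
  suff -> : (b / a) ^+ k = red w by apply/map_f/WP.
  have -> : red w = t ^- (k - q) * \prod_(x <- w) x.
    by rewrite /red -[k](mulKn _ n0) -sv sw mulnC divnMDl // addKn.
  apply: (@mulgI _ (t ^+ (k - q))); rewrite mulVKg.
  apply: (@mulgI _ (t ^+ q)); rewrite mulgA -expgnDr subnKC // -pw pv.
  exact/commute_sym/commuteX2.
have [i [j [ij _ e]]] := pigeonhole_seq powers.
symmetry; apply: divg1_eq; apply: (@torsion_fin_class_eq1 _ (j - i)) => //.
- exact/HM/HV.
- exact/fin_classM/fin_classV.
- by rewrite subn_gt0.
- exact/expg_sub_eq1/e/ltnW.
Qed.

(** Some power [a ^+ n] commutes with [b], so [a] and [a ^ b] are [n]-th roots of the same element
    and hence equal. *)
Lemma fin_class_commute (a b : G) :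
  prime_subgroup H -> {in H, forall h, h ^ b \in H} ->
  {in H, forall h, h ^ b^-1 \in H} ->
  a \in H -> fin_class H a -> fin_class H b -> commute a b.
Proof.
move=> H_prime bH bVH aH fa fb.
have [n n0 /commute_sym cn] := fin_class_commX fb aH.
apply/conj_eq_commute/(fin_class_roots_unique H_prime _ _ _ _ n0) => //.
- exact: bH.
(* The class of [a ^ b] is the image of that of [a] under conjugation by [b], because [b] normalizes
   [H]. *)
- have [s sP] := fa; exists [seq x ^ b | x <- s] => h hH.
  rewrite -[(a ^ b) ^ h](conjgKV b) (map_f (fun x => x ^ b)) //.
  have -> : ((a ^ b) ^ h) ^ b^-1 = a ^ (h ^ b^-1).
    by rewrite [h ^ _]conjgE invgK !conjgM.
  exact/sP/bVH.
- by rewrite -conjXg; apply/conj_eq_commute.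
Qed.

End FiniteClasses.

(** * The commutator of the cocycle on commuting pairs *)

Section Commutator.
Local Open Scope ring_scope.
Variables (R : realType) (G : groupType) (sigma : G -> G -> R[i]).
Hypothesis sigma_cocycle : two_cocycle sigma.

(* In the twisted group algebra, [u_g u_h = sigma_comm g h *: u_h u_g] whenever
   [g] and [h] commute. *)
Definition sigma_comm (g h : G) : R[i] := sigma g h / sigma h g.

Lemma two_cocycle_neq0 (g h : G) : sigma g h != 0.
Proof. by rewrite -normr_eq0 (two_cocycle_circle sigma_cocycle) oner_neq0. Qed.

Let sM := two_cocycle_mul sigma_cocycle.
Let s0 := two_cocycle_neq0.

Lemma sigma_comm_eq1 (g h : G) : sigma_comm g h = 1 <-> sigma g h = sigma h g.
Proof.
rewrite /sigma_comm; split=> [e|->]; last by rewrite divff.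
by rewrite -[LHS](divfK (s0 h g)) e mul1r.
Qed.

Lemma sigma_commV (g h : G) : sigma_comm h g = (sigma_comm g h)^-1.
Proof. by rewrite /sigma_comm invf_div. Qed.

Lemma sigma_comm1g (h : G) : sigma_comm 1%g h = 1.
Proof.
apply/sigma_comm_eq1.
by rewrite (two_cocycle_1l sigma_cocycle) (two_cocycle_1r sigma_cocycle).
Qed.

(** The cocycle identity at [(x, y, h)], [(x, h, y)] and [(h, x, y)] moves [h] past [y] and then
    past [x]. *)
Lemma sigma_commMl (x y h : G) : commute x h -> commute y h ->
  sigma_comm (x * y)%g h = sigma_comm x h * sigma_comm y h.
Proof.
move=> xh yh; rewrite /sigma_comm.
have e1 := sM x y h; have e2 := sM x h y; have e3 := sM h x y.
rewrite -xh in e3; rewrite -yh in e2.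
have -> : sigma (x * y)%g h = sigma x (y * h)%g * sigma y h / sigma x y.
  by rewrite -e1 mulrC mulKf.
have -> : sigma h (x * y)%g = sigma h x * sigma (x * h)%g y / sigma x y.
  by rewrite e3 mulfK.
have -> : sigma x (y * h)%g = sigma x h * sigma (x * h)%g y / sigma h y.
  by rewrite e2 mulfK.
by field; rewrite !s0.
Qed.

Lemma sigma_commXl (g h : G) (n : nat) : commute g h ->
  sigma_comm (g ^+ n)%g h = sigma_comm g h ^+ n.
Proof.
move=> gh; elim: n => [|n IHn]; first by rewrite sigma_comm1g.
rewrite expgS exprS sigma_commMl ?IHn //.
exact/commute_sym/commuteX/commute_sym.
Qed.

Lemma sigma_commXr (g h : G) (n : nat) : commute g h ->
  sigma_comm g (h ^+ n)%g = sigma_comm g h ^+ n.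
Proof.
move=> /commute_sym gh.
by rewrite sigma_commV sigma_commXl // sigma_commV exprVn invrK.
Qed.

Lemma sigma_comm_prod_eq1 (s : seq G) (h : G) :
  (forall x, x \in s -> commute x h) ->
  (forall x, x \in s -> sigma_comm x h = 1) ->
  sigma_comm (\prod_(x <- s) x)%g h = 1.
Proof.
elim: s => [|x s IHs] comm reg; first by rewrite big_nil sigma_comm1g.
have sub y : y \in s -> y \in x :: s by rewrite inE orbC => ->.
have sh : commute (\prod_(y <- s) y)%g h.
  rewrite big_seq; apply/commute_sym/commute_prod => y /sub ys.
  exact/commute_sym/comm.
rewrite big_cons sigma_commMl //; last exact/comm/mem_head.
rewrite reg ?mem_head // mul1r.
by apply: IHs => y /sub; [apply: comm | apply: reg].
Qed.

(* Conjugating by [u_k] multiplies [u_a] by the scalar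
   [sigma k (a ^ k) / sigma a k]. *)
Lemma sigma_comm_conj (k g h : G) : commute g h ->
  sigma_comm (g ^ k)%g (h ^ k)%g = sigma_comm g h.
Proof.
pose c a := sigma k (a ^ k)%g / sigma a k.
have coef a b :
    sigma a b = c (a * b)%g * sigma (a ^ k)%g (b ^ k)%g / (c a * c b).
  rewrite /c conjMg.
  have e1 := sM k (a ^ k)%g (b ^ k)%g; have e2 := sM a b k.
  have e3 := sM a k (b ^ k)%g.
  rewrite -conjgC in e1; rewrite (conjgC b) in e2.
  have -> : sigma k (a ^ k * b ^ k)%g =
      sigma k (a ^ k)%g * sigma (a * k)%g (b ^ k)%g / sigma (a ^ k)%g (b ^ k)%g.
    by rewrite e1 mulfK.
  have -> : sigma a b =
      sigma a (k * b ^ k)%g * sigma b k / sigma (a * b)%g k.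
    by rewrite -e2 mulfK.
  have -> : sigma a (k * b ^ k)%g =
      sigma a k * sigma (a * k)%g (b ^ k)%g / sigma k (b ^ k)%g.
    by rewrite e3 mulfK.
  by field; rewrite !s0.
(* By [coef], [sigma] and its conjugate by [k] differ by the coboundary of [c], which is symmetric
   on commuting pairs and cancels in the quotient. *)
move=> gh; rewrite /sigma_comm (coef g h) (coef h g) gh /c.
by field; rewrite !s0.
Qed.

Lemma sigma_regularP (H : {pred G}) (g : G) :
  sigma_regular sigma H g <->
  forall h, h \in H -> commute g h -> sigma_comm g h = 1.
Proof. by split=> reg h hH gh; apply/sigma_comm_eq1/reg. Qed.

Lemma sigma_regularJ (H : {pred G}) (g k : G) : group_closed H -> k \in H ->
  sigma_regular sigma H g -> sigma_regular sigma H (g ^ k)%g.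
Proof.
move=> H_group kH /sigma_regularP reg; apply/sigma_regularP => h hH ch.
have gh : commute g (h ^ k^-1)%g.
  by rewrite /commute -[g](conjgK k) -!conjMg ch.
rewrite -[h](conjgKV k) sigma_comm_conj // reg // conjgE invgK.
apply: (group_closedM H_group) => //.
by apply: (group_closedM H_group) => //; apply: (group_closedV H_group).
Qed.

End Commutator.

(** * Products modulo [H] and the equivalence *)

Lemma coset_expg (G : groupType) (H : {pred G}) (g : G) (s : seq G) :
  normal_subgroup predT H -> (forall x, x \in s -> x / g \in H) ->
  (\prod_(x <- s) x) / g ^+ size s \in H.
Proof.
move=> [H_group _ HJ]; elim: s => [|x s IHs] sH.
  by rewrite big_nil expg0 divg1; case: H_group.
have {}IHs := IHs (fun y ys => sH y (mem_behead (s := x :: s) ys)).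
(* Moving [g] past the quotient for the tail conjugates that quotient by [g], and [H] is normal. *)
have -> : (\prod_(y <- x :: s) y) / g ^+ size (x :: s) =
    x / g * (g * ((\prod_(y <- s) y) / g ^+ size s) * g^-1).
  by rewrite big_cons /= expgS invgM !mulgA mulgVK.
by apply: (group_closedM H_group); [exact/sH/mem_head | exact: HJ].
Qed.

Theorem theorem3p15 (R : realType) (G : groupType) (sigma : G -> G -> R[i])
    (H : {pred G}) (sigma_cocycle : two_cocycle sigma)
    (H_normal : normal_subgroup predT H) (H_prime : prime_subgroup H) :
  relative_kleppner sigma predT H <->
  kleppner sigma H /\ sigma_centralizer sigma H = [set 1].
Proof.
have [H_group _ HJ] := H_normal.
have HJr k h : h \in H -> h ^ k \in H.
  by move=> hH; rewrite conjgE mulgA -{2}[k]invgK; apply: HJ.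
have [H1 _] := H_group; have HM := group_closedM H_group.
have HV := group_closedV H_group.
split=> [rel|[klep cent] g _ g_neq1 g_reg].
  split=> [g _ g1 reg|]; first exact: rel.
  apply/seteqP; split=> [g [gH g_reg]|_ ->] /=; last first.
    split=> [h _|h _]; first exact/commute_sym/commute1.
    by rewrite (two_cocycle_1l sigma_cocycle) (two_cocycle_1r sigma_cocycle).
  apply: contrapT => g1; apply: (rel g) => // [h hH _|]; first exact: g_reg.
  apply/fin_classP => //; exists [:: g] => h hH.
  by rewrite inE; apply/eqP/conj_eq_commute/gH.
move=> /(fin_classP H_group) g_fin; apply: g_neq1.
have fin_comm a b : a \in H -> fin_class H a -> fin_class H b -> commute a b.
  by apply: fin_class_commute => // h hH; apply: HJr.
have [s [s_uniq sP]] := fin_class_exact g_fin.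
have gs : g \in s by apply/sP; exists 1; rewrite ?conjg1.
have s_fin x : x \in s -> fin_class H x.
  move=> /sP[k kH ->]; exists s => h hH; apply/sP.
  by exists (k * h); rewrite ?conjgM // HM.
have sgH x : x \in s -> x / g \in H.
  move=> /sP[k kH ->]; rewrite conjgE -mulgA; apply: HM; first exact: HV.
  exact: HJ.
have sg_fin x : x \in s -> fin_class H (x / g).
  by move=> xs; apply/fin_classM/fin_classV/g_fin/s_fin.
(* Write [x] as [(x / g) * g]: the first factor lies in [H] and commutes with [y]. For [g] against
   [y], split [y] in the same way. *)
have s_comm : {in s &, forall x y, commute x y}.
  move=> x y xs ys; rewrite -[x](mulgVK g); apply/commute_sym/commuteM.
    exact/commute_sym/fin_comm/s_fin/ys/sg_fin/xs/sgH.
  apply/commute_sym; rewrite -[y](mulgVK g); apply: commuteM => //.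
  apply/commute_sym/fin_comm => //; [exact: sgH | exact: sg_fin].
pose w := \prod_(x <- s) x; pose m := (size s)`!.
have w_cent h : h \in H -> commute w h.
  move=> hH; apply/conj_eq_commute; rewrite conjg_prod.
  rewrite -(big_map (fun x => x ^ h) predT id).
  (* Conjugation by [h] maps [s] injectively into itself, so it permutes [s]; the commuting product
     is unchanged. *)
  have sh_uniq : uniq [seq x ^ h | x <- s].
    by rewrite map_inj_uniq //; apply: conjg_inj.
  have sh_sub : {subset [seq x ^ h | x <- s] <= s}.
    move=> _ /mapP[x /sP[k kH ->] ->]; apply/sP.
    by exists (k * h); rewrite ?conjgM // HM.
  apply/esym/perm_prod_commute => //; rewrite perm_sym; apply: uniq_perm => //.
  by have [] := uniq_min_size sh_uniq sh_sub; rewrite ?size_map.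
have s_exp h x : h \in H -> x \in s -> commute x (h ^+ m).
  move=> hH xs.
  have [i|n [n0 ns xn]] := @finite_orbit_expg _ x h s.
    move/sP: xs => [k kH ->]; apply/sP; exists (k * h ^+ i).
      by apply/HM/group_closedX.
    by rewrite conjgM.
  have /dvdnP[q ->] : n %| m by rewrite dvdn_fact // n0.
  by rewrite mulnC expgnA; apply: commuteX.
have s_reg x : x \in s -> sigma_regular sigma H x.
  by move=> /sP[k kH ->]; apply: sigma_regularJ.
have wm1 : w ^+ m = 1.
  suff : sigma_centralizer sigma H (w ^+ m) by rewrite cent.
  split=> h hH; first exact/commute_sym/commuteX/commute_sym/w_cent.
  have wh := w_cent h hH; apply/(sigma_comm_eq1 sigma_cocycle).
  (* The exponent passes from [w] to [h]: unlike [h], the power [h ^+ m] is known to commute with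
     every factor of [w], so regularity of the factors applies. *)
  rewrite (sigma_commXl sigma_cocycle) // -(sigma_commXr sigma_cocycle) //.
  apply: (sigma_comm_prod_eq1 sigma_cocycle) => x xs; first exact: s_exp.
  apply: (sigma_regularP sigma_cocycle H x).1; first exact: s_reg.
    exact: group_closedX.
  exact: s_exp.
pose N := (size s * m)%N.
have N0 : (0 < N)%N by rewrite muln_gt0 fact_gt0 andbT; case: (s) gs.
have gNH : g ^+ N \in H.
  have wg_coset x : x \in nseq m w -> x / g ^+ size s \in H.
    by move=> /nseqP[-> _]; apply: coset_expg.
  have := coset_expg H_normal wg_coset.
  rewrite big_nseq iter_mulg_1 wm1 size_nseq div1g -expgnA => /HV.
  by rewrite invgK.
have comm_gN h : h \in H -> commute (g ^+ N) h -> commute g h.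
  move=> hH /conj_eq_commute; rewrite conjXg => e; apply/conj_eq_commute.
  have ghs : g ^ h \in s by apply/sP; exists h.
  (* Since [g] need not lie in [H], roots are compared through [g ^ h / g], which does; its [N]-th
     power is trivial as [g ^ h] and [g] commute. *)
  apply: divg1_eq; apply: (torsion_fin_class_eq1 H_group H_prime _ _ N0).
  - exact: sgH.
  - exact: sg_fin.
  - by rewrite expgnFl ?e ?mulgV //; apply: s_comm.
have gN1 : g ^+ N = 1.
  apply: contrapT => gN1; apply: (klep _ gNH gN1).
    apply/(sigma_regularP sigma_cocycle) => h hH /(comm_gN h hH) gh.
    rewrite (sigma_commXl sigma_cocycle) //.
    by rewrite (sigma_regularP sigma_cocycle H g).1 // expr1n.
  exact/(fin_classP H_group)/fin_classX.
have g_cent h : h \in H -> commute g h.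
  by move=> hH; apply: comm_gN => //; rewrite gN1; apply/commute_sym/commute1.
suff : sigma_centralizer sigma H g by rewrite cent.
by split=> // h hH; apply: g_reg => //; apply: g_cent.
Qed.
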